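(* Let $m$ be a positive integer. (Even case.) Let $\lambda=(\lambda_1\ge\cdots\ge\lambda_{2m}\ge0)$ be a partition and $y_i=2m+\lambda_i-i$ for $i=1,\ldots,2m$. Then \[ \int_{[0,1]^m} s_\lambda(x_1,x_1,x_2,x_2,\ldots,x_m,x_m) \prod_{1\le i<j\le m}(x_i-x_j)^4 \, \mathrm{d}x_1\cdots\mathrm{d}x_m=m!\prod_{1\le i<j\le 2m}\frac{y_i-y_j}{y_i+y_j}.\] (Odd case.) Let $\lambda=(\lambda_1\ge\cdots\ge\lambda_{2m+1}\ge0)$ be a partition and $y_i=2m+1+\lambda_i-i$ for $i=1,\ldots,2m+1$. Then \[\int_{[0,1]^m} s_\lambda(x_1,x_1,\ldots,x_m,x_m,1) \prod_{1\le i<j\le m}(x_i-x_j)^4 \prod_{1\le i\le m}(1-x_i)^2 \, \mathrm{d}x_1\cdots\mathrm{d}x_m=m!\prod_{1\le i<j\le 2m+1}\frac{y_i-y_j}{y_i+y_j}. \]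
   Context: For a partition $\lambda=(\lambda_1\ge\cdots\ge\lambda_N\ge 0)$, the Schur polynomial is the symmetric polynomial $s_\lambda(z_1,\ldots,z_N)=\det[z_i^{\lambda_j+N-j}]_{i,j=1}^N/\det[z_i^{N-j}]_{i,j=1}^N$; being a polynomial, it may be evaluated with repeated arguments. *)

(* Defs.v *)
From HB Require Import structures.
From mathcomp Require Import all_boot all_order all_algebra.
From mathcomp Require Import mpoly.
From mathcomp Require Import all_classical all_reals all_analysis.
From Stdlib Require Import ClassicalEpsilon.
Set Implicit Arguments. Unset Strict Implicit. Unset Printing Implicit Defensive.
Import Order.TTheory GRing.Theory Num.Theory.
Local Open Scope ring_scope.
Local Open Scope classical_set_scope.

Definition alternant (R : comNzRingType) (N : nat) (a : 'I_N -> nat)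
  : mpoly.mpoly N R :=
  \det (\matrix_(i < N, j < N) (mpoly.mpolyX R (mpoly.mX i)) ^+ a j).

(* Schur polynomial s_lambda in N variables: the polynomial p with
   p * det[z_i^(N-j)] = det[z_i^(lambda_j + N - j)]  (indices 1-based in the paper;
   here 0-based, so the exponents are N-1-j and lambda_j + (N-1-j)). *)
Definition schur (R : comNzRingType) (N : nat) (lam : 'I_N -> nat) : mpoly.mpoly N R :=
  epsilon (inhabits 0)
    (fun p : mpoly.mpoly N R =>
       p * @alternant R N (fun j : 'I_N => (N - 1 - j)%N)
       = @alternant R N (fun j : 'I_N => (lam j + (N - 1 - j))%N)).

Definition schur_eval (R : comNzRingType) (N : nat) (lam : 'I_N -> nat) (v : 'I_N -> R) : R :=
  mpoly.meval v (schur R lam).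

Definition is_partition (N : nat) (lam : 'I_N -> nat) : Prop :=
  forall i j : 'I_N, (i <= j)%N -> (lam j <= lam i)%N.

Fixpoint iint (R : realType) (m : nat) (f : seq R -> R) : R :=
  match m with
  | 0 => f [::]
  | m'.+1 => Rintegral (@lebesgue_measure R) `[0%R, 1%R]
               (fun t : R => iint m' (fun s => f (t :: s)))
  end.

(* Main.v *)
(**
Put [a_j = lambda_j + N - j] and [m = N / 2].  In the ring of polynomials in [h]
evaluate [s_lambda] at the points [x_k, x_k + h]: subtracting rows, both alternants are
divisible by [h^m], and after cancelling, [h = 0] turns the integrand into
[(-1)^m] times the confluent alternant, whose rows are [x_k^(a_j)] and
[a_j x_k^(a_j - 1)] (and a last row of ones when [N] is odd).  Expanding along the two rows
of one variable and integrating it out gives a recursion on [N], the exponents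
[a_p], [a_q] being removed with weight [a_q / (a_p + a_q)] up to sign.  The product
[prod_(i<j) (a_i - a_j) / (a_i + a_j)] (Schur's evaluation of a Pfaffian) satisfies the
same recursion; this is the partial fraction expansion of
[prod_j (t - a_j) / (t + a_j)] together with
[sum_p prod_(j != p) (a_p + a_j) / (a_p - a_j) = 0 or 1] according to the parity of [N].
*)
Require Import Defs.
From HB Require Import structures.
From mathcomp Require Import all_boot all_order all_algebra perm.
From mathcomp Require Import mpoly.
From mathcomp Require Import all_classical all_reals all_analysis.
From mathcomp Require Import ring zify.
From Stdlib Require Import ClassicalEpsilon.
Set Implicit Arguments. Unset Strict Implicit. Unset Printing Implicit Defensive.
Import Order.TTheory GRing.Theory Num.Theory.
Import numFieldNormedType.Exports.
Local Open Scope ring_scope.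

(** * Schur's Pfaffian product *)

(** Up to the factor [2 z_p], this is the residue at [t = z_p] of the product of all
    [(t + z_j) / (t - z_j)]. *)
Definition sumdiff (F : fieldType) n (z : 'I_n -> F) (p : 'I_n) : F :=
  \prod_(j < n | j != p) ((z p + z j) / (z p - z j)).

(** Lagrange interpolation: both sides have degree less than [n] and agree at the [n] distinct
    points [z k], where only the summand [q = k] survives. *)
Lemma prod_sumdiff_poly (F : fieldType) n (z : 'I_n -> F) : injective z ->
  \prod_i ('X - (z i)%:P) - \prod_i ('X - (- z i)%:P)
  = - \sum_q (z q *+ 2 * sumdiff z q) *: \prod_(j | j != q) ('X - (z j)%:P).
Proof.
move=> zI; apply/eqP; rewrite -subr_eq0 opprK; apply/eqP.
apply: (@roots_geq_poly_eq0 _ _ [seq z i | i : 'I_n]).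
- apply/allP => _ /codomP[k ->]; rewrite /root !hornerE !horner_prod horner_sum.
  rewrite (bigD1 k) //= !hornerE subrr mul0r sub0r.
  rewrite (bigD1 k) //= [X in _ + X](bigD1 k) //= [X in _ + (_ + X)]big1 => [|q qk].
    rewrite addr0 !hornerE !horner_prod /= addrC subr_eq0 opprK.
    rewrite mulr2n -mulrA; apply/eqP; congr (_ * _).
    rewrite /sumdiff -big_split; apply: eq_bigr => j jk /=.
    rewrite !hornerE divfK ?opprK // subr_eq0; apply: contra jk => /eqP /zI ->.
    exact/eqP.
  rewrite hornerZ horner_prod [X in _ * X](bigD1 k) 1?eq_sym //= !hornerE subrr.
  by rewrite /= mulr0 mul0r.
- by rewrite map_inj_uniq ?enum_uniq.
rewrite size_map -cardE card_ord.
apply: leq_trans (size_polyD _ _) _; rewrite geq_max; apply/andP; split.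
  (* The two monic products have the same leading coefficient, so their difference drops in
     degree. *)
  apply/leq_sizeP => j; rewrite coefB leq_eqVlt => /predU1P[<-|nj].
    have E (w : 'I_n -> F) : (\prod_i ('X - (w i)%:P))`_n = 1.
      have /monicP : \prod_i ('X - (w i)%:P) \is monic by apply: monic_prod_XsubC.
      rewrite lead_coefE size_prod_XsubC /=.
      by rewrite /index_enum -enumT size_enum_ord.
    by rewrite !E subrr.
  by rewrite !nth_default ?subrr // size_prod_XsubC /index_enum -enumT size_enum_ord.
apply: leq_trans (size_sum _ _ _) _; apply/bigmax_leqP => q _.
apply: leq_trans (size_scale_leq _ _) _.
have -> : \prod_(j | j != q) ('X - (z j)%:P) = \prod_(j <- enum (predC1 q)) ('X - (z j)%:P).
  by rewrite big_enum.
by rewrite size_prod_XsubC -cardE cardC1 card_ord prednK // (leq_trans _ (ltn_ord q)).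
Qed.

Lemma partial_fraction_prod (F : fieldType) n (z : 'I_n -> F) (s : F) :
  injective z -> (forall i, z i != s) ->
  1 - \prod_i ((s + z i) / (s - z i))
  = \sum_q (z q *+ 2 / (z q - s)) * sumdiff z q.
Proof.
move=> zI zs; have /(congr1 (horner^~ s)) := prod_sumdiff_poly zI.
have Pn0 : \prod_i (s - z i) != 0.
  by apply/prodf_neq0 => i _; rewrite subr_eq0 eq_sym.
rewrite !hornerE !horner_prod horner_sum => E.
rewrite prodf_div -[X in X - _](divff Pn0) -mulrBl.
have -> : \prod_i (s - z i) - \prod_i (s + z i) =
   \prod_i (('X - (z i)%:P).[s]) - \prod_i (('X - (- z i)%:P).[s]).
  by congr (_ - _); apply: eq_bigr => i _; rewrite !hornerE // opprK.
rewrite E -sumrN mulr_suml; apply: eq_bigr => q _.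
rewrite hornerZ horner_prod [X in _ / X](bigD1 q) //=.
rewrite (eq_bigr (fun j => s - z j)) => [|j _]; last by rewrite !hornerE.
have P' : \prod_(j | j != q) (s - z j) != 0.
  by apply/prodf_neq0 => i _; rewrite subr_eq0 eq_sym.
have s1 : s - z q != 0 by rewrite subr_eq0 eq_sym.
have s2 : z q - s != 0 by rewrite subr_eq0.
move: (\prod_(j | _) _) P' (sumdiff z q) => P P0 c.
by rewrite -mulr_natr; field; rewrite P0 s1 s2.
Qed.

Lemma sumdiff_lift (F : fieldType) n (y : 'I_n.+1 -> F) (p : 'I_n.+1) :
  sumdiff y p = \prod_j ((y p + y (lift p j)) / (y p - y (lift p j))).
Proof.
rewrite /sumdiff big_mkcond (bigD1_ord p) //= eqxx mul1r.
by apply: eq_bigr => j _; rewrite eq_sym neq_lift.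
Qed.

Lemma sumdiff_recl (F : fieldType) n (z : 'I_n.+1 -> F) (q : 'I_n) :
  sumdiff z (lift ord0 q)
  = (z (lift ord0 q) + z ord0) / (z (lift ord0 q) - z ord0)
    * sumdiff (z \o lift ord0) q.
Proof.
rewrite /sumdiff big_mkcond big_ord_recl neq_lift /=; congr (_ * _).
rewrite [RHS]big_mkcond; apply: eq_bigr => j _.
by rewrite (inj_eq lift_inj).
Qed.

(** Induction: the partial fraction identity for the other points is taken at [s = z ord0], using
    [(u + s) / (u - s) = 2u / (u - s) - 1]. The products cancel, leaving 1 minus the sum for [n]
    points. *)
Lemma sum_sumdiff (F : fieldType) n (z : 'I_n -> F) : injective z ->
  \sum_p sumdiff z p = (odd n)%:R.
Proof.
elim: n z => [|n IH] z zI; first by rewrite big_ord0.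
have zI' : injective (z \o lift ord0) by apply: inj_comp zI lift_inj.
have zs i : (z \o lift ord0) i != z ord0 by rewrite /= (inj_eq zI) eq_sym neq_lift.
rewrite big_ord_recl sumdiff_lift /=.
rewrite [X in _ + X](eq_bigr (fun q => (z \o lift ord0) q *+ 2
    / ((z \o lift ord0) q - z ord0) * sumdiff (z \o lift ord0) q
    - sumdiff (z \o lift ord0) q)) => [|q _]; last first.
  have z0 : z (lift ord0 q) - z ord0 != 0 by rewrite subr_eq0 zs.
  by rewrite sumdiff_recl /= -mulr_natr; field.
rewrite sumrB -(partial_fraction_prod zI' zs) IH //=.
by case: (odd n) => /=; ring.
Qed.

(** For even [n] this is Schur's value of the Pfaffian of the matrix [(y_i - y_j) / (y_i + y_j)]. *)
Definition schur_pfaffian (F : fieldType) n (y : 'I_n -> F) : F :=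
  \prod_(i < n) \prod_(j < n | (i < j)%N) ((y i - y j) / (y i + y j)).

(** At [s = - y p] the product in the partial fraction identity is the inverse of [sumdiff y p], so
    the inner sum is [(sumdiff y p - 1) / 2]; [sum_sumdiff] then gives the sum over [p]. *)
Lemma sum_sumdiff2 (F : numFieldType) n (y : 'I_n.+2 -> F) : injective y ->
  (forall i j, i != j -> y i + y j != 0) ->
  \sum_p \sum_q (y (lift p q) / (y p + y (lift p q)) * sumdiff y p
                * sumdiff (y \o lift p) q) = - (n./2.+1)%:R.
Proof.
move=> yI y0.
have step p : \sum_q (y (lift p q) / (y p + y (lift p q)) * sumdiff y p
                * sumdiff (y \o lift p) q) = (sumdiff y p - 1) / 2%:R.
  have zI : injective (y \o lift p) by apply: inj_comp yI lift_inj.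
  have zs i : (y \o lift p) i != - y p.
    by rewrite -subr_eq0 opprK y0 // eq_sym neq_lift.
  have := partial_fraction_prod zI zs => E.
  have E1 : sumdiff y p * \prod_i ((- y p + (y \o lift p) i) / (- y p - (y \o lift p) i)) = 1.
    rewrite sumdiff_lift.
    rewrite -big_split big1 // => j _ /=.
    have h1 : y p - y (lift p j) != 0 by rewrite subr_eq0 (inj_eq yI) neq_lift.
    have h2 : y p + y (lift p j) != 0 by rewrite y0 ?neq_lift.
    have h3 : - y p - y (lift p j) != 0 by rewrite -opprD oppr_eq0.
    by field; rewrite h1 h3.
  have -> : (sumdiff y p - 1) / 2%:R
    = sumdiff y p * (1 - \prod_i ((- y p + (y \o lift p) i) / (- y p - (y \o lift p) i))) / 2%:R.
    by rewrite mulrBr E1 mulr1.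
  rewrite E mulr_sumr mulr_suml; apply: eq_bigr => q _ /=.
  have h2 : y p + y (lift p q) != 0 by rewrite y0 ?neq_lift.
  have -> : y (lift p q) - - y p = y p + y (lift p q) by ring.
  by rewrite -mulr_natr; field; rewrite h2.
rewrite (eq_bigr _ (fun p _ => step p)) -mulr_suml sumrB sum_sumdiff //.
rewrite sumr_const card_ord /= negbK.
rewrite -{2}(odd_double_half n) -mul2n.
have -> : (odd n + 2 * n./2).+2%:R = (odd n)%:R + 2 * n./2%:R + 2 :> F.
  by rewrite -addn2 2!natrD natrM.
have -> : n./2.+1%:R = n./2%:R + 1 :> F by rewrite -addn1 natrD.
by field.
Qed.

Lemma prod_sign_lt (R : comNzRingType) n (p : nat) : (p <= n)%N ->
  \prod_(j < n) (if (j < p)%N then -1 else 1) = (-1) ^+ p :> R.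
Proof.
move=> pn; rewrite -big_mkcond prodr_const; congr (_ ^+ _).
rewrite -sum1_card (eq_bigl (fun j : 'I_n => j < p)%N) //.
by rewrite -(big_ord_widen _ (fun=> 1%N) pn) sum1_card card_ord.
Qed.

Lemma prod_ltn_lift (R : comNzRingType) n (g : 'I_n.+1 -> 'I_n.+1 -> R) (p : 'I_n.+1) :
  \prod_(i < n.+1) \prod_(j < n.+1 | (i < j)%N) g i j
  = \prod_(j < n) ((if (p < lift p j)%N then g p (lift p j) else 1)
             * (if (lift p j < p)%N then g (lift p j) p else 1))
    * \prod_(i < n) \prod_(j < n | (i < j)%N) g (lift p i) (lift p j).
Proof.
have E (i : 'I_n.+1) : \prod_(j < n.+1 | (i < j)%N) g i j
    = (if (i < p)%N then g i p else 1)
      * \prod_j (if (i < lift p j)%N then g i (lift p j) else 1).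
  by rewrite big_mkcond (bigD1_ord p).
rewrite (eq_bigr _ (fun i _ => E i)) (bigD1_ord p) //= ltnn mul1r.
rewrite !big_split /= mulrA; congr (_ * _).
apply: eq_bigr => i _; rewrite [RHS]big_mkcond; apply: eq_bigr => j _.
by rewrite /= [(bump _ _ < _)%N]ltnNge leq_bump2 -ltnNge.
Qed.

(** The factors involving [p] are inverse to those of [sumdiff y p] up to sign; each of the [p]
    indices below [p] contributes -1. *)
Lemma schur_pfaffian_lift (F : fieldType) n (y : 'I_n.+1 -> F) (p : 'I_n.+1) :
  injective y -> (forall i j, i != j -> y i + y j != 0) ->
  schur_pfaffian y * sumdiff y p = (-1) ^+ p * schur_pfaffian (y \o lift p).
Proof.
move=> yI y0; rewrite /schur_pfaffian sumdiff_lift (prod_ltn_lift _ p) mulrAC.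
congr (_ * _).
rewrite -!big_split /= -(@prod_sign_lt _ n p); last by rewrite -ltnS.
apply: eq_bigr => j _.
have h1 : y p - y (lift p j) != 0 by rewrite subr_eq0 (inj_eq yI) neq_lift.
have h2 : y p + y (lift p j) != 0 by rewrite y0 ?neq_lift.
rewrite /bump; case: (leqP p j) => pj.
  by rewrite add1n ltnS pj ltnNge leqW //=; field; rewrite h1 h2.
have h3 : y (lift p j) + y p != 0 by rewrite addrC.
rewrite add0n pj ltnNge (ltnW pj) /=; field.
by rewrite h1 ?h2 ?h3.
Qed.

(** * Iterated integrals of polynomial functions *)

Lemma Rintegral_deriv_poly (R : realType) (p : {poly R}) :
  Rintegral (@lebesgue_measure R) `[0%R, 1%R]%classic (horner p^`()) = p.[1] - p.[0].
Proof.
rewrite /Rintegral (@continuous_FTC2 _ _ (horner p)) //.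
- by apply: continuous_subspaceT => x; exact: continuous_horner.
- split; first by move=> x _; exact: derivable_horner.
  + by apply: cvg_at_right_filter; exact: continuous_horner.
  + by apply: cvg_at_left_filter; exact: continuous_horner.
- by move=> x _; rewrite derivE.
Qed.

Lemma Rintegral_sum_exp (R : realType) (I : Type) (r : seq I) (c : I -> R) (e : I -> nat) :
  Rintegral (@lebesgue_measure R) `[0%R, 1%R]%classic
    (fun t => \sum_(i <- r) c i * t ^+ e i)
  = \sum_(i <- r) c i / (e i).+1%:R.
Proof.
pose p := \sum_(i <- r) (c i / (e i).+1%:R) *: 'X^((e i).+1).
rewrite (_ : (fun t => _) = horner p^`()); last first.
  apply/funext => t; rewrite raddf_sum horner_sum; apply: eq_bigr => i _ /=.
  by rewrite derivZ derivXn hornerZ hornerMn hornerXn -mulr_natr /=; field.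
rewrite Rintegral_deriv_poly !horner_sum [X in _ - X]big1 => [|i _].
  by rewrite subr0; apply: eq_bigr => i _; rewrite hornerZ hornerXn expr1n mulr1.
by rewrite hornerZ hornerXn expr0n mulr0.
Qed.

Lemma eq_iint (R : realType) m (f g : seq R -> R) :
  (forall s, size s = m -> f s = g s) -> iint m f = iint m g.
Proof.
elim: m f g => [|m IH] f g fg /=; first exact: fg.
congr (Rintegral _ _ _); apply/funext => t; apply: IH => s sm.
by rewrite fg //= sm.
Qed.

(* The default value 1 of [nth] makes entry m of a list of length m equal to 1: this is
   the unpaired argument of the odd case. *)
Definition monom_eval (R : realType) m (ce : R * (nat -> nat)) (s : seq R) : R :=
  ce.1 * \prod_(k < m) nth 1 s k ^+ ce.2 k.

Lemma iint_monoms (R : realType) m (l : seq (R * (nat -> nat))) :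
  iint m (fun s => \sum_(ce <- l) monom_eval m ce s)
  = \sum_(ce <- l) ce.1 * \prod_(k < m) ((ce.2 k).+1%:R)^-1.
Proof.
elim: m l => [|m IH] l /=.
  by apply: eq_bigr => ce _; rewrite /monom_eval !big_ord0.
under [X in Rintegral _ _ X]eq_fun => t.
  (* For fixed [t] the integrand is again a sum of monomials in the remaining variables, with the
     power of [t] absorbed into the coefficients. *)
  rewrite (eq_iint (g := fun s =>
    \sum_(ce <- [seq (ce.1 * t ^+ ce.2 0%N, fun k => ce.2 k.+1) | ce <- l])
      monom_eval m ce s)); last first.
    move=> s _; rewrite big_map; apply: eq_bigr => ce _.
    by rewrite /monom_eval big_ord_recl mulrA.
  rewrite IH big_map /=.
  under eq_bigr do rewrite mulrAC.
  over.
rewrite Rintegral_sum_exp; apply: eq_bigr => ce _.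
by rewrite big_ord_recl /=; ring.
Qed.

(** On such functions linearity of [iint] follows from the closed value [iint_monoms], which avoids
    integrability arguments at each level of the nested integral. *)
Definition polyfun (R : realType) m (f : seq R -> R) := exists l,
  forall s, size s = m -> f s = \sum_(ce <- l) monom_eval m ce s.

Lemma polyfunD (R : realType) m (f g : seq R -> R) :
  polyfun m f -> polyfun m g -> polyfun m (fun s => f s + g s).
Proof.
by move=> [l1 h1] [l2 h2]; exists (l1 ++ l2) => s sm; rewrite big_cat h1 ?h2.
Qed.

Lemma polyfunM (R : realType) m (f g : seq R -> R) :
  polyfun m f -> polyfun m g -> polyfun m (fun s => f s * g s).
Proof.
move=> [l1 h1] [l2 h2].
exists [seq (c1.1 * c2.1, fun k => (c1.2 k + c2.2 k)%N) | c1 <- l1, c2 <- l2] => s sm.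
rewrite h1 ?h2 // big_allpairs_dep mulr_suml; apply: eq_bigr => c1 _.
rewrite mulr_sumr; apply: eq_bigr => c2 _; rewrite /monom_eval /=.
by under [X in _ = _ * X]eq_bigr do rewrite exprD; rewrite big_split /=; ring.
Qed.

Lemma polyfun_cst (R : realType) m (c : R) : polyfun m (fun=> c).
Proof.
exists [:: (c, fun=> 0%N)] => s _; rewrite big_seq1 /monom_eval big1 ?mulr1 //.
Qed.

Lemma polyfun_nthX (R : realType) m k a : polyfun m (fun s : seq R => nth 1 s k ^+ a).
Proof.
exists [:: (1, fun i => if i == k then a else 0%N)] => s sm.
rewrite big_seq1 /monom_eval mul1r /=; case: (ltnP k m) => km.
  rewrite (bigD1 (Ordinal km)) //= eqxx big1 ?mulr1 // => i /eqP ik.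
  by case: eqP => // E; case: ik; apply: val_inj.
(* Beyond the end of the list the default value 1 makes the function constant. *)
rewrite nth_default ?sm // expr1n big1 // => i _.
by case: eqP => // E; move: (ltn_ord i); rewrite E ltnNge km.
Qed.

Lemma polyfun_sum (R : realType) m (I : Type) (r : seq I) (f : I -> seq R -> R) :
  (forall i, polyfun m (f i)) -> polyfun m (fun s => \sum_(i <- r) f i s).
Proof.
move=> h; elim: r => [|i r [l IH]].
  by exists [::] => s _; rewrite !big_nil.
have [l' h'] := polyfunD (h i) (ex_intro _ l IH).
by exists l' => s sm; rewrite big_cons h'.
Qed.

Lemma polyfun_prod (R : realType) m (I : Type) (r : seq I) (f : I -> seq R -> R) :
  (forall i, polyfun m (f i)) -> polyfun m (fun s => \prod_(i <- r) f i s).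
Proof.
move=> h; elim: r => [|i r [l IH]].
  have [l hl] := polyfun_cst m (1 : R).
  by exists l => s sm; rewrite big_nil (hl s).
have [l' h'] := polyfunM (h i) (ex_intro _ l IH).
by exists l' => s sm; rewrite big_cons h'.
Qed.

Lemma iintD (R : realType) m (f g : seq R -> R) : polyfun m f -> polyfun m g ->
  iint m (fun s => f s + g s) = iint m f + iint m g.
Proof.
move=> [l1 h1] [l2 h2]; rewrite (eq_iint h1) (eq_iint h2) !iint_monoms -big_cat -iint_monoms.
by apply: eq_iint => s sm; rewrite big_cat h1 ?h2.
Qed.

Lemma iintZ (R : realType) m c (f : seq R -> R) :
  polyfun m f -> iint m (fun s => c * f s) = c * iint m f.
Proof.
move=> [l h]; rewrite (eq_iint h) iint_monoms.
rewrite (eq_iint (g := fun s => \sum_(ce <- [seq (c * ce.1, ce.2) | ce <- l]) monom_eval m ce s)).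
  by rewrite iint_monoms big_map mulr_sumr; apply: eq_bigr => ce _; rewrite mulrA.
move=> s sm; rewrite h // big_map mulr_sumr; apply: eq_bigr => ce _.
by rewrite /monom_eval mulrA.
Qed.

Lemma iint_sumZ (R : realType) m (I : Type) (r : seq I) (c : I -> R) (f : I -> seq R -> R) :
  (forall i, polyfun m (f i)) ->
  iint m (fun s => \sum_(i <- r) c i * f i s) = \sum_(i <- r) c i * iint m (f i).
Proof.
move=> h; elim: r => [|i r IH].
  rewrite big_nil (eq_iint (g := fun s => 0 * 1)) => [|s _]; last by rewrite big_nil mul0r.
  by rewrite iintZ ?mul0r //; apply: polyfun_cst.
rewrite big_cons -IH -iintZ // -iintD.
- by apply: eq_iint => s _; rewrite big_cons.
- by apply: polyfunM => //; apply: polyfun_cst.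
by apply: polyfun_sum => j; apply: polyfunM => //; apply: polyfun_cst.
Qed.

(** * The confluent alternant and its integral *)

(* For [a j = 0] the truncated exponent [(a j).-1] is harmless, its coefficient being 0. *)
Definition confmx (R : comNzRingType) N (a : 'I_N -> nat) (x : nat -> R) : 'M[R]_N :=
  \matrix_(i, j) (if odd i then (a j)%:R * x i./2 ^+ (a j).-1 else x i./2 ^+ a j).

(** Laplace expansion along the two rows of [x 0]; deleting two rows preserves parity, so the minor
    is again confluent, in the shifted variables. *)
Lemma det_confmx_recl (R : comNzRingType) N (a : 'I_N.+2 -> nat) (x : nat -> R) :
  \det (confmx a x) = \sum_(p < N.+2) \sum_(q < N.+1)
    ((-1) ^+ p * (-1) ^+ q * (a (lift p q))%:R * x 0%N ^+ (a p + (a (lift p q)).-1)%N)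
    * \det (confmx (fun j => a (lift p (lift q j))) (fun k => x k.+1)).
Proof.
rewrite (expand_det_row _ ord0); apply: eq_bigr => p _.
rewrite /cofactor (expand_det_row _ ord0) !mulr_sumr; apply: eq_bigr => q _.
rewrite /cofactor !mxE /= !add0n exprD.
rewrite [X in \det X](_ : _ = confmx (fun j => a (lift p (lift q j))) (fun k => x k.+1)).
  by ring.
by apply/matrixP => i j; rewrite !mxE /= negbK.
Qed.

Lemma polyfun_det_confmx (R : realType) m N (a : 'I_N -> nat) :
  polyfun m (fun s : seq R => \det (confmx a (nth 1 s))).
Proof.
have E (i j : 'I_N) : polyfun m (fun s : seq R => confmx a (nth 1 s) i j).
  have [l hl] : polyfun m (fun s : seq R => if odd i
      then (a j)%:R * nth 1 s i./2 ^+ (a j).-1 else nth 1 s i./2 ^+ a j).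
    case: odd; last exact: polyfun_nthX.
    by apply: polyfunM; [exact: polyfun_cst | exact: polyfun_nthX].
  by exists l => s sm; rewrite mxE hl.
apply: polyfun_sum => s; apply: polyfunM; first exact: polyfun_cst.
by apply: polyfun_prod => i; apply: E.
Qed.

(** Induction removing two exponents. Integrating out [x 0] gives the weight [y_q / (y_p + y_q)],
    two uses of [schur_pfaffian_lift] express each smaller product through [schur_pfaffian y], and
    [sum_sumdiff2] yields the factor [-(N./2 + 1)], which advances both the sign and the
    factorial. *)
Lemma iint_det_confmx (R : realType) N (a : 'I_N -> nat) : injective a ->
  iint N./2 (fun s : seq R => \det (confmx a (nth 1 s)))
  = (-1) ^+ N./2 * (N./2)`!%:R * schur_pfaffian (fun i => (a i)%:R).
Proof.
elim/ltn_ind: N a => -[|[|N]] IH a aI /=.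
- by rewrite det_mx00 fact0 !mul1r /schur_pfaffian big_ord0.
(* The single row is unpaired: its point is the default value 1. *)
- rewrite det_mx11 mxE /= expr1n fact0 !mul1r /schur_pfaffian big_ord1 big_pred0 // => i.
  by rewrite (ord1 i) ltnn.
pose y (i : 'I_N.+2) : R := (a i)%:R.
have yI : injective y by move=> i j /eqP; rewrite eqr_nat => /eqP /aI.
(* Distinct exponents cannot both be 0. *)
have y0 i j : i != j -> y i + y j != 0.
  move=> ij; rewrite -natrD pnatr_eq0 addn_eq0; apply: contra ij => /andP[/eqP ai /eqP aj].
  by apply/eqP/aI; rewrite ai aj.
under [X in Rintegral _ _ X]eq_fun => t.
  under [X in iint _ X]eq_fun do rewrite det_confmx_recl pair_big /=.
  rewrite iint_sumZ; last by move=> pq; apply: polyfun_det_confmx.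
  under eq_bigr do rewrite mulrAC.
  over.
rewrite Rintegral_sum_exp /=.
rewrite -(pair_big xpredT xpredT (fun (p : 'I_N.+2) (q : 'I_N.+1) =>
  (-1) ^+ p * (-1) ^+ q * (a (lift p q))%:R
  * iint N./2 (fun s => \det (confmx (fun j => a (lift p (lift q j))) (nth 1 s)))
  / (a p + (a (lift p q)).-1).+1%:R)) /=.
rewrite (eq_bigr (fun p : 'I_N.+2 => ((-1) ^+ N./2 * (N./2)`!%:R * schur_pfaffian y)
   * (\sum_q (y (lift p q) / (y p + y (lift p q)) * sumdiff y p
                * sumdiff (y \o lift p) q)))) => [|p _].
  by rewrite -mulr_sumr sum_sumdiff2 // exprS factS natrM; ring.
rewrite mulr_sumr; apply: eq_bigr => q _.
have zI : injective (y \o lift p) by apply: inj_comp yI lift_inj.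
have z0 i j : i != j -> (y \o lift p) i + (y \o lift p) j != 0.
  by move=> ij; rewrite y0 // (inj_eq lift_inj).
have E1 := schur_pfaffian_lift p yI y0.
have E2 := schur_pfaffian_lift q zI z0.
rewrite IH //; last by move=> i j /aI /lift_inj /lift_inj.
(* Integration produces the denominator [a_p + (a_q - 1) + 1]; if [a_q = 0] truncation spoils it,
   but the numerator vanishes. *)
have E3 : (a (lift p q))%:R / (a p + (a (lift p q)).-1).+1%:R
  = y (lift p q) / (y p + y (lift p q)) :> R.
  rewrite /y; case: (a (lift p q)) => [|b]; first by rewrite !mul0r.
  by rewrite /= -addnS natrD.
rewrite [LHS]mulrAC -[_ * (a (lift p q))%:R / _]mulrA E3.
set c := (-1) ^+ N./2 * _.
transitivity (c * (y (lift p q) / (y p + y (lift p q)))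
  * ((schur_pfaffian y * sumdiff y p) * sumdiff (y \o lift p) q)); last by ring.
rewrite E1 -(mulrA _ (schur_pfaffian _)) E2 /schur_pfaffian /=.
by rewrite /y; ring.
Qed.

(** * Schur polynomials at paired arguments *)

(* Reduce ['X^(a j)] modulo the monic polynomial with roots [w i] and evaluate at [w i]. *)
Lemma expmx_factor (S : comNzRingType) N (w : 'I_N -> S) (a : 'I_N -> nat) :
  exists C : 'M[S]_N, \matrix_(i < N, j < N) w i ^+ a j
    = (\matrix_(i < N, j < N) w i ^+ (N - 1 - j)) *m C.
Proof.
pose P := \prod_(i < N) ('X - (w i)%:P).
have Pm : P \is monic by apply: monic_prod_XsubC.
have Ps : size P = N.+1 by rewrite size_prod_XsubC /index_enum -enumT size_enum_ord.
pose r j := Pdiv.Ring.rmodp 'X^(a j) P.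
have rs j : (size (r j) <= N)%N.
  by rewrite -ltnS -Ps Pdiv.Ring.ltn_rmodpN0 ?monic_neq0.
exists (\matrix_(k, j) (r j)`_(N - 1 - k)); apply/matrixP => i j; rewrite !mxE.
have -> : w i ^+ a j = (r j).[w i].
  rewrite -hornerXn (Pdiv.RingMonic.rdivp_eq Pm 'X^(a j)) hornerD hornerM.
  by rewrite [P.[_]]horner_prod (bigD1 i) //= hornerXsubC subrr mul0r mulr0 add0r.
rewrite (horner_coef_wide _ (rs j)) (reindex_inj rev_ord_inj).
apply: eq_bigr => k _; rewrite !mxE mulrC /=.
by have -> : (N - k.+1 = N - 1 - k)%N by rewrite -subnDA.
Qed.

(** [epsilon] returns a solution once one exists; factoring the matrix of powers of the
    indeterminates provides the witness [\det C]. *)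
Lemma schurP (R : comNzRingType) N (lam : 'I_N -> nat) :
  schur R lam * alternant R (fun j : 'I_N => (N - 1 - j)%N)
  = alternant R (fun j : 'I_N => (lam j + (N - 1 - j))%N).
Proof.
apply: (@epsilon_spec _ _ (fun p => p * _ = _)).
have [C E] := expmx_factor (fun i : 'I_N => mpolyX R (mX i))
   (fun j : 'I_N => (lam j + (N - 1 - j))%N).
by exists (\det C); rewrite /alternant E det_mulmx mulrC.
Qed.

Lemma mmap_alternant (R S : comNzRingType) (f : {rmorphism R -> S}) N (w : 'I_N -> S)
  (a : 'I_N -> nat) :
  mmap f w (alternant R a) = \det (\matrix_(i, j) w i ^+ a j).
Proof.
rewrite /alternant -det_map_mx; congr (\det _).
apply/matrixP => i j; rewrite !mxE rmorphXn /= mmapX.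
have -> : mX i = mnm1 i by apply/mnmP => k; rewrite !mnmE eq_sym.
by rewrite mmap1U.
Qed.

Lemma horner_mmap_polyC (R : comNzRingType) N (w : 'I_N -> {poly R}) (c : R) (p : {mpoly R[N]}) :
  (mmap polyC w p).[c] = meval (fun i => (w i).[c]) p.
Proof.
rewrite /mmap mevalE horner_sum; apply: eq_bigr => m _.
rewrite hornerM hornerC /mmap1 horner_prod; congr (_ * _).
by apply: eq_bigr => i _; rewrite horner_exp.
Qed.

(** Rows and columns of the transposed Vandermonde matrix are both reversed; the two equal signs
    cancel. *)
Lemma det_revVandermonde (S : comNzRingType) N (w : 'I_N -> S) :
  \det (\matrix_(i < N, j < N) w i ^+ (N - 1 - j))
  = \prod_(i < N) \prod_(j < N | (i < j)%N) (w i - w j).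
Proof.
pose s := perm (@rev_ord_inj N).
pose v : 'rV[S]_N := \row_i w (rev_ord i).
have -> : \matrix_(i < N, j < N) w i ^+ (N - 1 - j)
   = row_perm s (col_perm s (Vandermonde N v)^T).
  apply/matrixP => i j; rewrite !mxE !permE rev_ordK /=.
  by rewrite -subnDA.
rewrite row_permE col_permE !det_mulmx !det_perm odd_permV det_tr det_Vandermonde.
rewrite mulrCA -signr_addb addbb mulr1.
rewrite (reindex_inj rev_ord_inj) (exchange_big_dep xpredT) //= (reindex_inj rev_ord_inj) /=.
apply: eq_bigr => i _; rewrite big_mkcond [RHS]big_mkcond; apply: eq_bigr => j _ /=.
rewrite !mxE !rev_ordK.
by have -> : (N - j.+1 < N - i.+1)%N = (i < j)%N by rewrite ltn_sub2lE // ltnS.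
Qed.

(** * Paired points and the limit [h = 0] *)

Lemma prod_ord_ltn (S : comNzRingType) n (f : nat -> nat -> S) :
  \prod_(i < n) \prod_(j < n | (i < j)%N) f i j
  = \prod_(0 <= j < n) \prod_(0 <= i < j) f i j.
Proof.
rewrite (exchange_big_dep xpredT) //= big_mkord; apply: eq_bigr => j _.
by rewrite big_mkord (big_ord_widen n (fun i => f i j)) // ltnW.
Qed.

Lemma prod_half (S : comNzRingType) m (f : nat -> S) :
  \prod_(0 <= i < m.*2) f i./2 = \prod_(i < m) f i ^+ 2.
Proof.
elim: m => [|m IH]; first by rewrite big_ord0 big_geq.
rewrite doubleS !big_nat_recr //= IH big_ord_recr /= uphalf_double doubleK.
by rewrite -mulrA expr2.
Qed.

(* The limit as h -> 0 of [w_i - w_j], divided by h when i and j form a pair, where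
   [w_(2k) = x_k] and [w_(2k+1) = x_k + h]. *)
Definition confdiff (S : comNzRingType) (x : nat -> S) (i j : nat) : S :=
  if odd j && (i.+1 == j) then -1 else x i./2 - x j./2.

(** In the inductive step the new indices [2m] and [2m + 1] each contribute the squares
    [(x_i - x_m)^2], and their own pair contributes -1. *)
Lemma prod_confdiff (S : comNzRingType) (x : nat -> S) m :
  \prod_(i < m.*2) \prod_(j < m.*2 | (i < j)%N) confdiff x i j
  = (-1) ^+ m * \prod_(i < m) \prod_(j < m | (i < j)%N) (x i - x j) ^+ 4.
Proof.
rewrite !prod_ord_ltn (prod_ord_ltn m (fun i j => (x i - x j) ^+ 4)).
elim: m => [|m IH]; first by rewrite !big_geq // mulr1.
rewrite doubleS 2?big_nat_recr //= IH.
have E : \prod_(0 <= i < m.*2) confdiff x i m.*2 = \prod_(i < m) (x i - x m) ^+ 2.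
  rewrite -(prod_half m (fun i => x i - x m)); apply: eq_big_nat => i _.
  by rewrite /confdiff odd_double doubleK.
have E' : \prod_(0 <= i < m.*2) confdiff x i m.*2.+1 = \prod_(i < m) (x i - x m) ^+ 2.
  rewrite -(prod_half m (fun i => x i - x m)); apply: eq_big_nat => i /andP[_ im].
  by rewrite /confdiff eqSS (ltn_eqF im) andbF /= uphalf_double.
rewrite [\prod_(0 <= i < m.*2.+1) _]big_nat_recr //= E E'.
rewrite {1}/confdiff /= odd_double eqxx /=.
rewrite [\prod_(0 <= j < m.+1) _]big_nat_recr //= [\prod_(0 <= i < m) (_ ^+ 4)]big_mkord.
rewrite [X in _ = _ * (_ * X)](eq_bigr (fun i : 'I_m =>
  (x i - x m) ^+ 2 * (x i - x m) ^+ 2)) => [|i _].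
  by rewrite [X in _ = _ * (_ * X)]big_split exprS /=; ring.
by rewrite -exprD.
Qed.

(** The last index [2m] is unpaired and has half [m], so it contributes only squares. *)
Lemma prod_confdiffS (S : comNzRingType) (x : nat -> S) m :
  \prod_(i < m.*2.+1) \prod_(j < m.*2.+1 | (i < j)%N) confdiff x i j
  = (-1) ^+ m * \prod_(i < m) \prod_(j < m | (i < j)%N) (x i - x j) ^+ 4
    * \prod_(i < m) (x i - x m) ^+ 2.
Proof.
rewrite -prod_confdiff !prod_ord_ltn big_nat_recr //=; congr (_ * _).
rewrite -(prod_half m (fun i => x i - x m)); apply: eq_big_nat => i _.
by rewrite /confdiff odd_double doubleK.
Qed.

(* The indeterminate ['X] is the h of the pairs x, x + h. *)
Definition split_points (R : comNzRingType) (x : nat -> R) (i : nat) : {poly R} :=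
  (x i./2)%:P + (if odd i then 'X else 0).

(** The power of [h] extracted for index [i] from both alternants, to be cancelled later. *)
Definition pair_step (R : comNzRingType) (i : nat) : {poly R} := if odd i then 'X else 1.

(** Subtracting row [2k] from row [2k + 1] leaves [h] times divided differences of powers, which at
    [h = 0] become derivatives. *)
Lemma det_split_points (R : comNzRingType) N (x : nat -> R) (a : 'I_N -> nat) :
  exists B : 'M[{poly R}]_N,
   \det (\matrix_(i < N, j < N) split_points x i ^+ a j)
     = \prod_(i < N) pair_step R i * \det B
   /\ map_mx (horner^~ 0) B = confmx a x.
Proof.
(* [L] undoes the row subtraction: it is lower triangular with diagonal [pair_step]. *)
pose L : 'M[{poly R}]_N := \matrix_(i, k)
  (if i == k then pair_step R i else (odd i && (k.+1 == i))%:R).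
pose B : 'M[{poly R}]_N := \matrix_(i, j) if odd i then
   \sum_(k < a j) split_points x i ^+ ((a j).-1 - k) * (x i./2)%:P ^+ k
   else (x i./2)%:P ^+ a j.
exists B; split.
  have -> : \matrix_(i < N, j < N) split_points x i ^+ a j = L *m B.
    apply/matrixP => i j; rewrite !mxE (bigD1 i) //= !mxE eqxx /pair_step.
    have [oi|oi] := boolP (odd i); last first.
      rewrite big1 => [|k ki]; last by rewrite !mxE eq_sym (negbTE ki) (negbTE oi) mul0r.
      by rewrite mul1r addr0 /split_points (negbTE oi) addr0.
    have i0 : (0 < i)%N by case: (nat_of_ord i) oi.
    have iN : (i.-1 < N)%N by rewrite prednK // ltnW.
    pose i' := Ordinal iN.
    have i'i : i' != i by rewrite -val_eqE /= neq_ltn prednK // leqnn.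
    rewrite [X in _ = _ + X](bigD1 i') //= [X in _ + (_ + X)]big1 => [|k /andP[ki ki']]; last first.
      rewrite !mxE eq_sym (negbTE ki); case: eqP => [E|]; last by rewrite andbF mul0r.
      by case/eqP: ki'; apply: val_inj; rewrite /= -E.
    rewrite !mxE [i == _]eq_sym (negbTE i'i) /= prednK // eqxx oi /= mul1r addr0.
    have oi' : odd i.-1 = false by move: oi; rewrite -{1}(prednK i0) /= => /negbTE.
    have hi : i.-1./2 = i./2 by move: oi'; lia.
    rewrite oi' hi.
    (* In this factorization of [u ^+ a - v ^+ a], the points are [u = x + h] and [v = x], so
       [u - v] is ['X]. *)
    have := subrXX (split_points x i) (x i./2)%:P (a j).
    rewrite {2}/split_points oi addrAC subrr add0r => <-.
    by rewrite subrK.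
  rewrite det_mulmx det_trig; last first.
    apply/is_trig_mxP => i j ij; rewrite mxE.
    rewrite -val_eqE /= ltn_eqF //; case: eqP => [E|]; last by rewrite andbF.
    by move: ij; rewrite -E ltnNge leqnSn.
  by congr (_ * _); apply: eq_bigr => i _; rewrite mxE eqxx.
apply/matrixP => i j; rewrite !mxE; case: ifP => oi; last by rewrite horner_exp hornerC.
rewrite horner_sum (eq_bigr (fun=> x i./2 ^+ (a j).-1)) => [|k _].
  by rewrite sumr_const card_ord mulr_natl.
rewrite hornerM !horner_exp hornerC /split_points oi !hornerE -exprD subnK //.
by case: k => k /=; case: (a j).
Qed.

(** Only the differences [x_k - (x_k + h) = - h] within a pair are forced to vanish at [h = 0];
    their factor [h] is extracted, leaving -1. *)
Lemma prod_split_points (R : comNzRingType) N (x : nat -> R) :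
  exists G : {poly R},
   \prod_(i < N) \prod_(j < N | (i < j)%N) (split_points x i - split_points x j)
     = \prod_(i < N) pair_step R i * G
   /\ G.[0] = \prod_(i < N) \prod_(j < N | (i < j)%N) confdiff x i j.
Proof.
pose g (i j : nat) : {poly R} := if odd j && (i.+1 == j) then -1
   else split_points x i - split_points x j.
exists (\prod_(i < N) \prod_(j < N | (i < j)%N) g i j); split.
  rewrite (prod_ord_ltn _ (fun i j => split_points x i - split_points x j)).
  rewrite (prod_ord_ltn _ g) -(big_mkord xpredT (pair_step R)) -big_split /=.
  apply: eq_big_nat => -[|j] _.
    by rewrite !big_geq // mulr1.
  rewrite !big_nat_recr //= mulrCA /g eqxx andbT; congr (_ * _).
    apply: eq_big_nat => i /andP[_ ij].
    by rewrite eqSS (ltn_eqF ij) andbF.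
  rewrite /pair_step /=; case: (boolP (odd j)) => oj /=; first by rewrite mul1r.
  rewrite /split_points /= oj (negbTE oj) /= uphalf_half (negbTE oj) add0n.
  by ring.
rewrite horner_prod; apply: eq_bigr => i _; rewrite horner_prod; apply: eq_bigr => j _.
rewrite /g /confdiff; case: ifP => _; rewrite ?hornerE //.
by rewrite /split_points; do 2 case: ifP => _; rewrite !hornerE.
Qed.

(** The defining identity of the Schur polynomial is evaluated at the points [x_k], [x_k + h]; the
    common power of [h] is cancelled in the integral domain [{poly R}] before setting [h = 0]. *)
Lemma schur_eval_pairs (R : idomainType) N (lam : 'I_N -> nat) (x : nat -> R) :
  schur_eval lam (fun i => x i./2)
    * \prod_(i < N) \prod_(j < N | (i < j)%N) confdiff x i j
  = \det (confmx (fun j => (lam j + (N - 1 - j))%N) x).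
Proof.
pose w (i : 'I_N) := split_points x i.
have := congr1 (mmap polyC w) (schurP R lam).
rewrite rmorphM /= !mmap_alternant det_revVandermonde.
have [G [-> G0]] := prod_split_points N x.
have [B [-> B0]] := det_split_points x (fun j : 'I_N => (lam j + (N - 1 - j))%N).
have H0 : \prod_(i < N) pair_step R i != 0.
  by apply/prodf_neq0 => i _; rewrite /pair_step; case: ifP; rewrite ?polyX_eq0 ?oner_eq0.
rewrite mulrCA => /(mulfI H0) /(congr1 (horner^~ 0)) /=.
rewrite hornerM horner_mmap_polyC G0 -horner_evalE -det_map_mx.
rewrite (_ : map_mx _ B = map_mx (horner^~ 0) B) // B0 => <-.
congr (_ * _); rewrite /schur_eval; congr (meval _ _).
by apply/funext => i; rewrite /w /split_points; case: ifP; rewrite !hornerE.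
Qed.

(** * Exponents of a partition and the two integrals *)

Lemma shifted_partition_inj N (lam : 'I_N -> nat) : is_partition lam ->
  injective (fun j : 'I_N => lam j + (N - 1 - j))%N.
Proof.
move=> lamP; suff lt (i j : 'I_N) : (i < j)%N ->
    (lam j + (N - 1 - j) < lam i + (N - 1 - i))%N.
  move=> i j /= E; case: (ltngtP i j) => [/lt|/lt|/val_inj //];
  by rewrite E ltnn.
move=> ij; rewrite -addnS leq_add ?lamP ?(ltnW ij) //.
by have := ltn_ord j; lia.
Qed.

(** The sign in the integrand is the one from [prod_confdiff]; it cancels the sign of
    [iint_det_confmx]. *)
Lemma iint_signed_det (R : realType) N (lam : 'I_N -> nat) : is_partition lam ->
  iint N./2 (fun s : seq R => (-1) ^+ N./2
    * \det (confmx (fun j => (lam j + (N - 1 - j))%N) (nth 1 s)))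
  = (N./2)`!%:R * schur_pfaffian (fun i : 'I_N => (N + lam i - i.+1)%:R).
Proof.
move=> lamP; rewrite iintZ; last exact: polyfun_det_confmx.
rewrite iint_det_confmx; last exact: shifted_partition_inj.
rewrite !mulrA -expr2 sqrr_sign mul1r; congr (_ * schur_pfaffian _).
by apply/funext => i; congr _%:R; have := ltn_ord i; lia.
Qed.

Theorem theorem3p5 (R : realType) (m : nat) (hm : (0 < m)%N) :
  (* even case *)
  (forall lam : 'I_(2 * m) -> nat, is_partition lam ->
     let y := fun i : 'I_(2 * m) => ((2 * m + lam i - i.+1)%N)%:R : R in
     iint m (fun x : seq R =>
        schur_eval lam (fun i : 'I_(2 * m) => nth 0 x (i %/ 2)%N)
        * \prod_(i < m) \prod_(j < m | (i < j)%N) (nth 0 x i - nth 0 x j) ^+ 4)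
     = (m`!)%:R * \prod_(i < 2 * m) \prod_(j < 2 * m | (i < j)%N)
                    ((y i - y j) / (y i + y j)))
  /\
  (* odd case *)
  (forall lam : 'I_(2 * m + 1) -> nat, is_partition lam ->
     let y := fun i : 'I_(2 * m + 1) => ((2 * m + 1 + lam i - i.+1)%N)%:R : R in
     iint m (fun x : seq R =>
        schur_eval lam (fun i : 'I_(2 * m + 1) =>
                          if (i < 2 * m)%N then nth 0 x (i %/ 2)%N else 1)
        * \prod_(i < m) \prod_(j < m | (i < j)%N) (nth 0 x i - nth 0 x j) ^+ 4
        * \prod_(i < m) (1 - nth 0 x i) ^+ 2)
     = (m`!)%:R * \prod_(i < 2 * m + 1) \prod_(j < 2 * m + 1 | (i < j)%N)
                    ((y i - y j) / (y i + y j))).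
Proof.
split=> lam lamP y.
- have N2 : (2 * m)./2 = m by rewrite mul2n doubleK.
  have := iint_signed_det R lamP; rewrite N2 => <-.
  (* Read backwards, [schur_eval_pairs] turns the determinant into the Schur value times the product
     of differences. *)
  apply: eq_iint => s sm; rewrite -schur_eval_pairs.
  have := prod_confdiff (nth 1 s) m; rewrite -mul2n => ->.
  rewrite [RHS]mulrCA signrMK; congr (_ * _).
    congr (schur_eval _ _); apply/funext => i; rewrite divn2.
    (* All halves are below [m], so the defaults 0 and 1 give the same entries. *)
    by apply: set_nth_default; rewrite sm; have := ltn_ord i; lia.
  apply: eq_bigr => i _; apply: eq_bigr => j _.
  by rewrite !(set_nth_default 1 0) ?sm.
have N2 : (2 * m + 1)./2 = m by rewrite addn1 mul2n /= uphalf_double.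
have := iint_signed_det R lamP; rewrite N2 => <-.
apply: eq_iint => s sm; rewrite -schur_eval_pairs.
have := prod_confdiffS (nth 1 s) m; rewrite -mul2n -addn1 => ->.
rewrite [RHS]mulrCA -[(-1) ^+ m * _ * _]mulrA signrMK -mulrA; congr (_ * (_ * _)).
- congr (schur_eval _ _); apply/funext => i; case: ifP => im.
    by rewrite divn2; apply: set_nth_default; rewrite sm; lia.
  (* Index [2m] has half [m], the length of [s], so the default 1 is the last argument. *)
  by rewrite nth_default // sm; lia.
- apply: eq_bigr => i _; apply: eq_bigr => j _.
  by rewrite !(set_nth_default 1 0) ?sm.
(* Again [x_m] is the default 1; the square absorbs the order of subtraction. *)
apply: eq_bigr => i _; rewrite [nth 1 s m]nth_default ?sm //.
by rewrite (set_nth_default 1 0) ?sm // -sqrrN opprB.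
Qed.
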